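(* Let $({\bf H}^n,{\bf E}^n)_{0\le n\le M}$ be the solution of the scheme $$\mu\,\frac{{\bf H}^{n+1}-{\bf H}^n}{\tau}=-\hat{\bf D}\,\frac{{\bf E}^{n+1}+{\bf E}^n}{2},\qquad \epsilon\,\frac{{\bf E}^{n+1}-{\bf E}^n}{\tau}=\hat{\bf D}\,\frac{{\bf H}^{n+1}+{\bf H}^n}{2},\qquad n=0,\dots,M-1 .$$ Then $$\bar\nabla\cdot(\epsilon{\bf E}^{n+1})=\bar\nabla\cdot(\epsilon{\bf E}^n)\quad\text{and}\quad \bar\nabla\cdot(\mu{\bf H}^{n+1})=\bar\nabla\cdot(\mu{\bf H}^n),\qquad n=0,\dots,M-1,$$ where $\bar\nabla\cdot(\mu{\bf H})={\bf D}_1(\mu{\bf H}_x)+{\bf D}_2(\mu{\bf H}_y)+{\bf D}_3(\mu{\bf H}_z)$ and $\bar\nabla\cdot(\epsilon{\bf E})={\bf D}_1(\epsilon{\bf E}_x)+{\bf D}_2(\epsilon{\bf E}_y)+{\bf D}_3(\epsilon{\bf E}_z)$.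
   Context: Grid: $N_x,N_y,N_z$ are even positive integers, the domain is $[x_L,x_R]\times[y_L,y_R]\times[z_L,z_R]$, $L_w=w_R-w_L$, $h_w=L_w/N_w$, $\mu_w=2\pi/L_w$ for $w\in\{x,y,z\}$; $w_j=w_L+(j-1)h_w$, $j=1,\dots,N_w$. Time step $\tau=T/M$, $T>0$, $M$ a positive integer. $\epsilon,\mu>0$ are constants and $c=1/\sqrt{\epsilon\mu}$. Put $s_1=N_xN_yN_z$. ${\bf D}_1^w\in\mathbb R^{N_w\times N_w}$ is the Fourier spectral first-order differentiation matrix: $({\bf D}_1^w)_{j,l}=\tfrac12\mu_w(-1)^{j+l}\cot\big(\mu_w\tfrac{w_j-w_l}{2}\big)$ for $j\ne l$, and $({\bf D}_1^w)_{j,j}=0$. Put ${\bf D}_1={\bf I}_{N_z}\otimes{\bf I}_{N_y}\otimes{\bf D}_1^x$, ${\bf D}_2={\bf I}_{N_z}\otimes{\bf D}_1^y\otimes{\bf I}_{N_x}$, ${\bf D}_3={\bf D}_1^z\otimes{\bf I}_{N_y}\otimes{\bf I}_{N_x}$ ($\otimes$ the Kronecker product), acting on grid functions $U_{j,k,m}$ ordered as vectors in $\mathbb R^{s_1}$ with $j$ varying fastest, then $k$, then $m$. Let $${\bf D}=\begin{pmatrix}0&-{\bf D}_3&{\bf D}_2\\ {\bf D}_3&0&-{\bf D}_1\\ -{\bf D}_2&{\bf D}_1&0\end{pmatrix},\qquad \hat{\bf D}={\bf D}+\frac{c^2\tau^2}{12}{\bf D}^3+\frac{c^4\tau^4}{120}{\bf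 D}^5 .$$ Unknowns ${\bf H}^n=(({\bf H}_x^n)^T,({\bf H}_y^n)^T,({\bf H}_z^n)^T)^T$ and ${\bf E}^n=(({\bf E}_x^n)^T,({\bf E}_y^n)^T,({\bf E}_z^n)^T)^T$ lie in $\mathbb R^{3s_1}$. *)

(* Defs.v *)
From HB Require Import structures.
From mathcomp Require Import all_boot all_order all_algebra.
From mathcomp Require Import reals trigo.
From mathcomp Require Export mxtens.
Set Implicit Arguments.
Unset Strict Implicit.
Unset Printing Implicit Defensive.
Import Order.TTheory GRing.Theory Num.Theory.
Local Open Scope ring_scope.

Definition cot (R : realType) (x : R) : R := cos x / sin x.

(* Grid indices are 0-based: the ordinal j stands for the 1-based index j + 1,
   so w_j = wL + (j - 1) h becomes wL + j h, and the parity of j + l is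
   unchanged. *)
Definition grid_node (R : realType) (wL wR : R) (N : nat) (j : 'I_N) : R :=
  wL + j%:R * ((wR - wL) / N%:R).

Definition fourier_diff (R : realType) (wL wR : R) (N : nat) : 'M[R]_N :=
  let mu_w := 2 * pi / (wR - wL) in
  \matrix_(j < N, l < N)
    if j == l then 0
    else 2^-1 * mu_w * (-1) ^+ (j + l)
         * cot (mu_w * ((grid_node wL wR j - grid_node wL wR l) / 2)).

(* Written in the order produced by [tensmx], whose index for A *t B is
   (index in A) * (dimension of B) + (index in B): the value U_(j,k,m) sits at
   position (m * Ny + k) * Nx + j, i.e. j varies fastest, then k, then m. *)
Definition s1 (Nx Ny Nz : nat) : nat := (Nz * Ny * Nx)%N.

Definition D1 (R : realType) (Nx Ny Nz : nat) (xL xR : R) :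
    'M[R]_(s1 Nx Ny Nz) :=
  (1%:M : 'M[R]_Nz) *t (1%:M : 'M[R]_Ny) *t fourier_diff xL xR Nx.

Definition D2 (R : realType) (Nx Ny Nz : nat) (yL yR : R) :
    'M[R]_(s1 Nx Ny Nz) :=
  (1%:M : 'M[R]_Nz) *t fourier_diff yL yR Ny *t (1%:M : 'M[R]_Nx).

Definition D3 (R : realType) (Nx Ny Nz : nat) (zL zR : R) :
    'M[R]_(s1 Nx Ny Nz) :=
  fourier_diff zL zR Nz *t (1%:M : 'M[R]_Ny) *t (1%:M : 'M[R]_Nx).

Definition xcomp (R : realType) (s : nat) (V : 'cV[R]_(s + (s + s))) :
    'cV[R]_s := usubmx V.

Definition ycomp (R : realType) (s : nat) (V : 'cV[R]_(s + (s + s))) :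
    'cV[R]_s := usubmx (dsubmx V).

Definition zcomp (R : realType) (s : nat) (V : 'cV[R]_(s + (s + s))) :
    'cV[R]_s := dsubmx (dsubmx V).

Definition curl_mx (R : realType) (s : nat) (A1 A2 A3 : 'M[R]_s) :
    'M[R]_(s + (s + s)) :=
  col_mx (row_mx 0 (row_mx (- A3) A2))
    (col_mx (row_mx A3 (row_mx 0 (- A1)))
            (row_mx (- A2) (row_mx A1 0))).

Definition div_op (R : realType) (s : nat) (A1 A2 A3 : 'M[R]_s)
    (V : 'cV[R]_(s + (s + s))) : 'cV[R]_s :=
  A1 *m xcomp V + A2 *m ycomp V + A3 *m zcomp V.

Definition hat_mx (R : realType) (n : nat) (c tau : R) (D : 'M[R]_n) :
    'M[R]_n :=
  D + (c ^+ 2 * tau ^+ 2 / 12) *: D ^+ 3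
    + (c ^+ 4 * tau ^+ 4 / 120) *: D ^+ 5.

(* Main.v *)
Require Import Defs.
From mathcomp Require Import all_boot all_order all_algebra.
From mathcomp Require Import reals trigo.
Set Implicit Arguments.
Unset Strict Implicit.
Unset Printing Implicit Defensive.
Import Order.TTheory GRing.Theory Num.Theory.
Local Open Scope ring_scope.

(** This is the discrete form of div curl = 0.  The discrete divergence is left
    multiplication by the block row (A1 A2 A3), and its product with the curl
    matrix has the commutators of the Ai as entries.  Differentiation matrices
    acting on different factors of a Kronecker product commute, so the
    divergence annihilates the curl ([div_mx_curl]).  The modified curl is an
    odd polynomial in the curl, hence has the curl as a left factor, and is
    annihilated as well ([mulmx_hat_eq0]).  Each step of the scheme writes the
    increments of mu H and eps E as tau times vectors in the range of the
    modified curl, so these increments are divergence-free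
    ([mulmx_increment_eq]). *)

Definition div_mx (R : nzRingType) (s : nat) (A1 A2 A3 : 'M[R]_s) :
    'M[R]_(s, s + (s + s)) := row_mx A1 (row_mx A2 A3).

Lemma div_opE (R : realType) (s : nat) (A1 A2 A3 : 'M[R]_s)
    (V : 'cV[R]_(s + (s + s))) :
  div_op A1 A2 A3 V = div_mx A1 A2 A3 *m V.
Proof.
rewrite -[V in RHS]vsubmxK -[dsubmx V]vsubmxK.
by rewrite /div_mx !mul_row_col addrA.
Qed.

(** Column j of the product is a difference Ai Ak - Ak Ai with i, k the two
    indices other than j, so commutation of the Ai makes it vanish. *)
Lemma div_mx_curl (R : realType) (s : nat) (A1 A2 A3 : 'M[R]_s) :
  comm_mx A1 A2 -> comm_mx A1 A3 -> comm_mx A2 A3 ->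
  div_mx A1 A2 A3 *m curl_mx A1 A2 A3 = 0.
Proof.
rewrite /comm_mx => A12 A13 A23.
rewrite /div_mx /curl_mx !mul_row_col !mul_mx_row !mulmx0 !mulmxN.
rewrite !add_row_mx !add0r !addr0 -A12 -A13 -A23.
by rewrite !subrr addNr !row_mx0.
Qed.

(** Every power of D occurring in [hat_mx] is positive, so D can be factored
    out on the left. *)
Lemma mulmx_hat_eq0 (R : realType) (m n : nat) (c tau : R) (B : 'M[R]_(m, n))
    (D : 'M[R]_n) :
  B *m D = 0 -> B *m hat_mx c tau D = 0.
Proof.
move=> BD0.
have BDX k : B *m D ^+ k.+1 = 0 by rewrite exprS mulmxA BD0 mul0mx.
by rewrite /hat_mx !mulmxDr -!scalemxAr BD0 !BDX !scaler0 !addr0.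
Qed.

(** A time step of the form of the scheme, with weight a, moves a U along the
    range of K, hence preserves every linear quantity B vanishing there. *)
Lemma mulmx_increment_eq (R : fieldType) (m n : nat) (a t : R)
    (B : 'M[R]_(m, n)) (K : 'M[R]_n) (U U' W : 'cV[R]_n) :
  t != 0 -> B *m K = 0 -> a *: (t^-1 *: (U' - U)) = K *m W ->
  B *m (a *: U') = B *m (a *: U).
Proof.
move=> t0 BK0 step; apply/eqP; rewrite -subr_eq0 -mulmxBr -scalerBr.
rewrite -[U' - U](scalerKV t0) scalerA mulrC -scalerA step.
by rewrite -scalemxAr mulmxA BK0 mul0mx scaler0.
Qed.

(** Both products act by one differentiation matrix on each of two tensor
    factors, whatever the order; the same mixed-product rule gives the other
    two pairs of directions. *)
Lemma D1_D2_comm (R : realType) (Nx Ny Nz : nat) (xL xR yL yR : R) :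
  comm_mx (D1 Nx Ny Nz xL xR) (D2 Nx Ny Nz yL yR).
Proof. by rewrite /comm_mx /D1 /D2 !tensmx_mul !mul1mx !mulmx1. Qed.

Lemma D1_D3_comm (R : realType) (Nx Ny Nz : nat) (xL xR zL zR : R) :
  comm_mx (D1 Nx Ny Nz xL xR) (D3 Nx Ny Nz zL zR).
Proof. by rewrite /comm_mx /D1 /D3 !tensmx_mul !mul1mx !mulmx1. Qed.

Lemma D2_D3_comm (R : realType) (Nx Ny Nz : nat) (yL yR zL zR : R) :
  comm_mx (D2 Nx Ny Nz yL yR) (D3 Nx Ny Nz zL zR).
Proof. by rewrite /comm_mx /D2 /D3 !tensmx_mul !mul1mx !mulmx1. Qed.

Theorem theorem4p6 (R : realType) (Nx Ny Nz M : nat)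
    (xL xR yL yR zL zR T eps mu : R)
    (hNx : (0 < Nx)%N && ~~ odd Nx)
    (hNy : (0 < Ny)%N && ~~ odd Ny)
    (hNz : (0 < Nz)%N && ~~ odd Nz)
    (hx : xL < xR) (hy : yL < yR) (hz : zL < zR)
    (hT : 0 < T) (hM : (0 < M)%N) (heps : 0 < eps) (hmu : 0 < mu)
    (H E : nat -> 'cV[R]_(s1 Nx Ny Nz + (s1 Nx Ny Nz + s1 Nx Ny Nz))) :
  let tau := T / M%:R in
  let c := 1 / Num.sqrt (eps * mu) in
  let A1 := D1 Nx Ny Nz xL xR in
  let A2 := D2 Nx Ny Nz yL yR in
  let A3 := D3 Nx Ny Nz zL zR in
  let Dhat := hat_mx c tau (curl_mx A1 A2 A3) in
  (forall n : nat, (n < M)%N ->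
     mu *: (tau^-1 *: (H n.+1 - H n)) = - Dhat *m (2^-1 *: (E n.+1 + E n)) /\
     eps *: (tau^-1 *: (E n.+1 - E n)) = Dhat *m (2^-1 *: (H n.+1 + H n))) ->
  forall n : nat, (n < M)%N ->
     div_op A1 A2 A3 (eps *: E n.+1) = div_op A1 A2 A3 (eps *: E n) /\
     div_op A1 A2 A3 (mu *: H n.+1) = div_op A1 A2 A3 (mu *: H n).
Proof.
move=> tau c A1 A2 A3 Dhat scheme n ltnM.
have tau0 : tau != 0 by rewrite gt_eqF // divr_gt0 // ltr0n.
have divD0 : div_mx A1 A2 A3 *m Dhat = 0.
  apply/mulmx_hat_eq0/div_mx_curl.
  - exact: D1_D2_comm.
  - exact: D1_D3_comm.
  - exact: D2_D3_comm.
have [stepH stepE] := scheme n ltnM.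
rewrite !div_opE; split; first exact: mulmx_increment_eq tau0 divD0 stepE.
by apply: mulmx_increment_eq tau0 _ stepH; rewrite mulmxN divD0 oppr0.
Qed.
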